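(* Let $q$ be an odd prime. For a positive integer $d$, let $\mathrm{Pred}(d)=\{d':\ 1\le d'<d,\ d/d'\text{ is a prime}\}$ be the set of all maximal proper divisors of $d$. Then the number $\mathcal N(2q)$ of (centrally) nilpotent loops of order $2q$, up to isomorphism, is $$\mathcal N(2q)=\sum_{d\mid q-1}\frac1d\left(2^{(q-2)d}+\sum_{\emptyset\ne D\subseteq\mathrm{Pred}(d)}(-1)^{|D|}\cdot2^{(q-2)\gcd D}\right),$$ where the outer sum is over all positive divisors $d$ of $q-1$, and $\gcd D$ is the greatest common divisor of the elements of $D$.
   Context: A loop is a set with a binary operation having a two-sided neutral element such that all left and right translations are bijections. The center $Z(Q)$ of a loop $Q$ is the set of all $x\in Q$ with $xy=yx$, $(xy)z=x(yz)$, $(yx)z=y(xz)$, $(yz)x=y(zx)$ for all $y,z\in Q$; it is a normal subloop (kernel of a loop homomorphism). The upper central series is defined by $Z_0(Q)=1$, $Z_{i+1}(Q)/Z_i(Q)=Z(Q/Z_i(Q))$ (with $Z_{i+1}(Q)$ the full preimage in $Q$). $Q$ is (centrally) nilpotent if $Z_n(Q)=Q$ for some $n\ge0$. *)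

(* Defs.v *)
From HB Require Import structures.
From mathcomp Require Import all_boot all_order all_algebra.
From mathcomp Require Import boolp.

Set Implicit Arguments.
Unset Strict Implicit.
Unset Printing Implicit Defensive.

Section Loops.
Variables (T : finType) (op : T -> T -> T).

Definition neutral (e : T) := forall x, op e x = x /\ op x e = x.

Definition is_loop :=
  [/\ exists e, neutral e,
      forall x, bijective (fun y => op x y) &
      forall x, bijective (fun y => op y x)].

(* The center of the loop with carrier A and multiplication op.  The carrier is
   explicit so that quotients, whose elements are subsets of T, are covered. *)
Definition center (A : {set T}) : {set T} :=
  [set x in A | [forall y in A, forall z in A,
     [&& op x y == op y x,
         op (op x y) z == op x (op y z),
         op (op y x) z == op y (op x z) &
         op (op y z) x == op y (op z x)]]].

Definition lcoset_of (N : {set T}) (x : T) : {set T} := [set op x n | n in N].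

(* The carrier and the multiplication of Q/N.  For a normal subloop N, the
   elementwise product of xN and yN is the coset (xy)N. *)
Definition quotient_carrier (N : {set T}) : {set {set T}} :=
  [set lcoset_of N x | x in [set: T]].

Definition quotient_op (A B : {set T}) : {set T} :=
  [set op a b | a in A, b in B].

End Loops.

(* In a loop Z_0 is the singleton of the unique neutral element. *)
Fixpoint upper_central (T : finType) (op : T -> T -> T) (i : nat) : {set T} :=
  if i is j.+1 then
    let N := upper_central op j in
    [set x | lcoset_of op N x
               \in center (quotient_op op) (quotient_carrier op N)]
  else [set e | `[< neutral op e >]].

Definition nilpotent (T : finType) (op : T -> T -> T) :=
  exists n, upper_central op n = [set: T].

Definition isomorphic (T1 T2 : finType)
    (op1 : T1 -> T1 -> T1) (op2 : T2 -> T2 -> T2) :=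
  exists2 f : T1 -> T2, bijective f & {morph f : x y / op1 x y >-> op2 x y}.

Definition table_op (T : finType) (a : {ffun T * T -> T}) (x y : T) : T :=
  a (x, y).

Definition nilpotent_loops (n : nat) : {set {ffun 'I_n * 'I_n -> 'I_n}} :=
  [set a | `[< is_loop (table_op a) /\ nilpotent (table_op a) >]].

Definition iso_rel (n : nat) : rel {ffun 'I_n * 'I_n -> 'I_n} :=
  fun a b => `[< isomorphic (table_op a) (table_op b) >].

Lemma iso_rel_equiv (n : nat) :
  {in nilpotent_loops n & &, equivalence_rel (@iso_rel n)}.
Proof.
have S (a b : {ffun 'I_n * 'I_n -> 'I_n}) : iso_rel a b -> iso_rel b a.
  move=> /asboolP[f [g fK gK] fM]; apply/asboolP; exists g; first by exists f.
  by move=> x y; apply: (can_inj fK); rewrite fM !gK.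
have Tr (a b c : {ffun 'I_n * 'I_n -> 'I_n}) :
    iso_rel a b -> iso_rel b c -> iso_rel a c.
  move=> /asboolP[f fB fM] /asboolP[g gB gM]; apply/asboolP.
  by exists (g \o f); [exact: bij_comp | move=> x y /=; rewrite fM gM].
move=> a b c _ _ _; split.
  by apply/asboolP; exists id => //; exists id.
by move=> ab; apply/idP/idP; [apply: Tr; apply: S | apply: Tr].
Qed.

(* Every loop of order n is isomorphic to one with carrier 'I_n, so this is the
   number of nilpotent loops of order n up to isomorphism. *)
Definition num_nilpotent_loops (n : nat) : nat :=
  #|equivalence_partition (@iso_rel n) (nilpotent_loops n)|.

Definition Pred (d : nat) : {set 'I_d} :=
  [set d' : 'I_d | [&& 0 < d', d' %| d & prime (d %/ d')]].

Definition gcd_set (d : nat) (D : {set 'I_d}) : nat :=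
  \big[gcdn/0]_(i in D) i.

(* Main.v *)
(* A nilpotent loop of order 2q is a central extension of F_q by a group {e, z}
   of order 2.  As 2 is invertible mod q, the representatives of the cosets can
   be chosen compatibly with doubling, and in a unique way: every extension comes
   from exactly one cocycle theta : F_q x F_q -> bool vanishing when x = 0, y = 0
   or x = y, and two of them give isomorphic loops iff they differ by a scaling
   (x, y) |-> (u x, u y) with u in F_q^*.  Writing (x, y) = (g^i, g^i c) for a
   primitive root g and c <> 0, 1, such a cocycle is a colouring of Z/(q-1) by
   the 2^(q-2) functions of c, and scaling is rotation.  The loops are therefore
   counted by necklaces of length q-1: each contributes 1/d for each of its d
   rotations, the colourings fixed by the d-th rotation number 2^((q-2)d), and
   those of exact period d are obtained by inclusion-exclusion over the maximal
   proper divisors of d. *)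
Require Import Defs.
From HB Require Import structures.
From mathcomp Require Import fingroup cyclic pgroup finfield.
From mathcomp Require Import all_boot all_order all_algebra.
From mathcomp Require Import boolp zify.
Import GRing.Theory Num.Theory.
Set Implicit Arguments.
Unset Strict Implicit.
Unset Printing Implicit Defensive.

(** * Counting equivalence classes *)

Lemma card_equivalence_partition (T : finType) (D : {set T}) (R : rel T) :
  {in D & &, equivalence_rel R} ->
  (#|equivalence_partition R D|%:R =
     \sum_(x in D) (#|[set y in D | R x y]|%:R)^-1 :> rat)%R.
Proof.
move=> eqR; have parP := equivalence_partitionP eqR.
have [/eqP covP tiP P0] := and3P parP.
(* A class [A] contributes [#|A|] terms equal to [#|A|^-1], hence 1 in total. *)
rewrite -{2}covP big_trivIset //= -sum1_card natr_sum; apply: eq_bigr => A AP.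
have A_gt0 : (#|A|%:R != 0 :> rat)%R.
  rewrite pnatr_eq0 -lt0n card_gt0; apply: contraNneq P0 => <-.
  exact: AP.
rewrite (eq_bigr (fun=> (#|A|%:R)^-1)%R) ?sumr_const -?[RHS]mulr_natl ?mulfV //.
move=> x xA; congr ((_%:R)^-1)%R; congr #|pred_of_set _|.
case/imsetP: AP xA => z zD ->; rewrite inE => /andP[xD zx].
apply/setP => y; rewrite !inE; apply: andb_id2l => yD.
by rewrite (eqR z x y zD xD yD).2.
Qed.

(** Taking preimages under [f] is a bijection between the two sets of classes: every class of [R]
    meets the image of [f]. This lets colorings be counted instead of multiplication tables. *)
Lemma card_equivalence_partition_preim (S T : finType) (D : {set T})
    (R : rel T) (R' : rel S) (f : S -> T) :
  {in D & &, equivalence_rel R} ->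
  (forall x, f x \in D) -> (forall x y, R (f x) (f y) = R' x y) ->
  (forall y, y \in D -> exists x, R (f x) y) ->
  #|equivalence_partition R D| = #|equivalence_partition R' [set: S]|.
Proof.
move=> eqR fD fR fsurj.
have RE x y z : x \in D -> y \in D -> z \in D -> R x y -> R x z = R y z.
  by move=> xD yD zD; apply: (eqR x y z xD yD zD).2.
have Rxx x : x \in D -> R x x by move=> xD; rewrite (eqR x x x).
have RC x y : x \in D -> y \in D -> R x y = R y x.
  move=> xD yD; apply/idP/idP => xy.
    by rewrite -(RE x y x) // Rxx.
  by rewrite -(RE y x y) // Rxx.
rewrite -(@card_in_imset _ _ (fun A : {set T} => f @^-1: A)).
  congr #|pred_of_set _|; apply/setP => A; apply/imsetP/imsetP.
    move=> [_ /imsetP[y yD ->] ->]; have [x Rxy] := fsurj y yD.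
    by exists x => //; apply/setP => z; rewrite !inE fD -fR /= (RE _ y).
  move=> [x _ ->]; exists [set y in D | R (f x) y]; first exact: imset_f.
  by apply/setP => z; rewrite !inE fD -fR.
move=> _ _ /imsetP[y yD ->] /imsetP[z zD ->] /setP yz.
have [x Rxy] := fsurj y yD; have xD := fD x.
move/(_ x): yz; rewrite !inE xD /= -RC // Rxy -RC // => /esym Rxz.
apply/setP => w; rewrite !inE; apply: andb_id2l => wD.
by rewrite -(RE (f x) y w) // (RE (f x) z w).
Qed.

(** * Orbit lengths under an injective map *)

Section Order.
Variables (T : finType) (f : T -> T) (f_inj : injective f).

Lemma iter_eq_order n x : (iter n f x == x) = (order f x %| n).
Proof.
have itM k : iter (k * order f x) f x = x.
  by elim: k => // k IHk; rewrite mulSn iterD IHk iter_order.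
rewrite {1}(divn_eq n (order f x)) addnC iterD itM /dvdn.
have lt := ltn_pmod n (order_gt0 f x).
apply/eqP/eqP => [|->//] h.
by rewrite -(findex_iter lt) h findex0.
Qed.

Lemma card_fconnect x : #|[set y in [set: T] | fconnect f x y]| = order f x.
Proof. by rewrite /order; apply: eq_card => y; rewrite !inE. Qed.

End Order.

(** * Inclusion-exclusion over maximal proper divisors *)

(** When [n] is a proper divisor of [d] and [p] is a prime factor of [d %/ n], the quotient of [d]
    by [p] lies in [Pred d] and is still a multiple of [n]. *)
Lemma dvdn_PredE d n : 0 < d -> n %| d ->
  [exists i in Pred d, n %| (i : nat)] = (n != d).
Proof.
move=> d_gt0 nd; apply/existsP/idP.
  move=> [i /andP[]]; rewrite inE => /and3P[i0 id pr] ni.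
  by apply: contraTneq (dvdn_leq i0 ni) => ->; rewrite -ltnNge.
move=> n_neq_d; have n_gt0 : 0 < n by apply: dvdn_gt0 nd.
have ndE : (d %/ n * n)%N = d by rewrite divnK.
have dn_gt1 : 1 < d %/ n.
  by case: (d %/ n) ndE => [|[|k]] //; lia.
pose p := pdiv (d %/ n); have pp : prime p by apply: pdiv_prime.
have [k kE] := dvdnP (pdiv_dvd (d %/ n)).
have dE : d = (k * n * p)%N by rewrite -ndE kE -/p mulnAC.
have kn_gt0 : 0 < k * n by move: d_gt0; rewrite dE muln_gt0 => /andP[].
have kn_d : k * n < d by rewrite [ltnRHS]dE ltn_Pmulr // prime_gt1.
exists (Ordinal kn_d); rewrite inE /= kn_gt0 {1}dE dvdn_mulr //.
by rewrite {1}dE mulKn // pp dvdn_mull.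
Qed.

Lemma dvdn_gcd_set d n (D : {set 'I_d}) :
  (n %| gcd_set D) = [forall i in D, n %| (i : nat)].
Proof.
by apply/dvdn_biggcdP/forallP => h i; apply/implyP/h.
Qed.

Lemma sum_sign_subset (T : finType) (S : {set T}) :
  (\sum_(D : {set T} | D \subset S) (-1) ^+ #|D| = (S == set0)%:R :> rat)%R.
Proof.
(* Expanding this product gives the signed sum over subsets of [S]; each element of [S] contributes
   a factor -1 + 1 = 0. *)
transitivity (\prod_(i : T) ((if i \in S then -1 else 0) + 1 : rat))%R.
  rewrite bigA_distr big_mkcond; apply: eq_bigr => D _.
  case: ifP => [DS|/subsetPn[i iD iS]].
    rewrite -prodr_const [LHS]big_mkcond; apply: eq_bigr => i _.
    by case: ifP => // /(subsetP DS)->.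
  by rewrite (bigD1 i) //= iD (negPf iS) mul0r.
case: (set_0Vmem S) => [->|[i iS]].
  by rewrite eqxx big1 // => i _; rewrite inE add0r.
rewrite (bigD1 i) //= iS addNr mul0r; case: eqP => // S0.
by rewrite S0 inE in iS.
Qed.

(** The sets [D] that contribute are the nonempty subsets of [S], the members of [Pred d] divisible
    by [n]. The leading 1 is the term of the empty set, so the total is 1 exactly when [S] is empty,
    that is, when [n = d]. *)
Lemma sum_sign_Pred d n : 0 < d -> n %| d ->
  (1 + \sum_(D : {set 'I_d} | (D != set0) && (D \subset Pred d))
     (-1) ^+ #|D| * (n %| gcd_set D)%:R = (n == d)%:R :> rat)%R.
Proof.
move=> d_gt0 nd; pose S := [set i in Pred d | n %| (i : nat)].
have SE : (S == set0) = (n == d).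
  rewrite -[n == d]negbK -dvdn_PredE //; apply/eqP/existsPn => [S0 i|h].
    by move/setP/(_ i): S0; rewrite !inE => ->.
  by apply/setP => i; rewrite !inE; apply: negbTE; have := h i; rewrite inE.
rewrite -SE -sum_sign_subset [RHS](bigD1 set0) ?sub0set //= cards0 expr0.
congr (_ + _)%R.
rewrite [LHS]big_mkcond [RHS]big_mkcond; apply: eq_bigr => D _.
rewrite dvdn_gcd_set.
have -> : D \subset S = (D \subset Pred d) && [forall i in D, n %| (i : nat)].
  apply/subsetP/andP => [h|[/subsetP h1 /forall_inP h2] i iD].
    split; first by apply/subsetP => i /h; rewrite inE => /andP[].
    by apply/forall_inP => i /h; rewrite inE => /andP[].
  by rewrite inE h1 // h2.
by case: eqP; case: (D \subset _); case: [forall _ in D, _];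
  rewrite ?mulr1 ?mulr0.
Qed.

(** * Necklaces as orbits of rotation *)

Section Necklaces.
Variables (n : nat) (X : finType) (n_gt0 : 0 < n).
Implicit Type f : {ffun 'I_n -> X}.

Definition rotate f : {ffun 'I_n -> X} := [ffun i => f (ordS i)].

Lemma rotate_inj : injective rotate.
Proof.
move=> f g /ffunP fg; apply/ffunP => i.
by move: (fg (ord_pred i)); rewrite !ffunE ord_predK.
Qed.

Lemma iter_rotate k f (i j : 'I_n) :
  j = i + k %[mod n] -> iter k rotate f i = f j.
Proof.
elim: k i j => [|k IHk] i j.
  rewrite addn0 !modn_small ?ltn_ord // => ji; congr (f _); exact/val_inj.
by move=> ji; rewrite iterS ffunE (IHk _ j) //= modnDml addSnnS.
Qed.

Definition tile d (d_gt0 : 0 < d) (h : {ffun 'I_d -> X}) : {ffun 'I_n -> X} :=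
  [ffun i : 'I_n => h (Ordinal (ltn_pmod i d_gt0))].

(** A coloring fixed by the [d]-th rotation is a word of length [d] repeated around the necklace,
    and [tile] is injective on such words. *)
Lemma card_iter_rotate d :
  d %| n -> #|[set f | iter d rotate f == f]| = #|X| ^ d.
Proof.
move=> dn; have d_gt0 := dvdn_gt0 n_gt0 dn; have d_le := dvdn_leq n_gt0 dn.
transitivity #|{ffun 'I_d -> X}|; last by rewrite card_ffun card_ord.
rewrite -(card_imset predT (f := tile d_gt0)); last first.
  move=> h k /ffunP hk; apply/ffunP => i; move: (hk (widen_ord d_le i)).
  by rewrite !ffunE; congr (h _ = k _); apply: val_inj; rewrite /= modn_small.
apply: eq_card => f; rewrite inE; apply/eqP/imsetP => [fd|[h _ ->]]; last first.
  apply/ffunP => i.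
  (* As [d] divides [n], reducing [i + d] modulo [n] preserves its residue modulo [d]. *)
  rewrite (@iter_rotate _ _ _ (Ordinal (ltn_pmod (i + d) n_gt0))) /= ?modn_mod //.
  by rewrite !ffunE; congr (h _); apply: val_inj; rewrite /= modn_dvdm // modnDr.
exists [ffun i => f (widen_ord d_le i)] => //; apply/ffunP => i; rewrite !ffunE.
have fdk k : iter (k * d) rotate f = f.
  by elim: k => // k IHk; rewrite mulSn iterD IHk.
(* Rotating [i %/ d] times by [d] carries position [i %% d] to [i]. *)
rewrite -{2}(fdk (i %/ d)) (@iter_rotate _ _ _ i) //=.
by rewrite addnC -divn_eq.
Qed.

Lemma card_necklaces :
  (#|equivalence_partition (fconnect rotate) [set: {ffun 'I_n -> X}]|%:R =
   \sum_(d <- divisors n) d%:R^-1 *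
      (#|X|%:R ^+ d +
       \sum_(D : {set 'I_d} | (D != set0) && (D \subset Pred d))
          (-1) ^+ #|D| * #|X|%:R ^+ gcd_set D) :> rat)%R.
Proof.
rewrite card_equivalence_partition; last first.
  move=> f g h _ _ _; split=> [|fg]; first exact: connect0.
  exact: (same_connect (fconnect_sym rotate_inj)).
have ordn f : order rotate f %| n.
  rewrite -(iter_eq_order rotate_inj); apply/eqP/ffunP => i.
  by rewrite (@iter_rotate _ _ _ i) // modnDr.
under eq_bigr do rewrite card_fconnect.
(* The weight of [f] is the inverse of its period; it is spread over all divisors of [n] so that the
   two sums can be exchanged. *)
rewrite (eq_bigr (fun f => \sum_(d <- divisors n)
    d%:R^-1 * (order rotate f == d)%:R)%R); last first.
  move=> f _; rewrite (bigD1_seq (order rotate f)) ?divisors_uniq //=; last first.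
    by rewrite -dvdn_divisors.
  rewrite eqxx mulr1 big1 ?addr0 // => d.
  by rewrite eq_sym => /negPf->; rewrite mulr0.
rewrite exchange_big /= !big_seq; apply: eq_bigr => d.
rewrite -dvdn_divisors // => dn; have d_gt0 := dvdn_gt0 n_gt0 dn.
rewrite -mulr_sumr; congr (_ * _)%R.
have fixE k : k %| n ->
    (\sum_(f : {ffun 'I_n -> X}) (order rotate f %| k)%:R = #|X|%:R ^+ k :> rat)%R.
  move=> kn; rewrite -natrX -card_iter_rotate // -sum1_card natr_sum [RHS]big_mkcond.
  apply: eq_bigr => f _; rewrite inE (iter_eq_order rotate_inj).
  by case: (_ %| k).
(* Exact period [d] means that the period divides [d] and no maximal proper divisor of [d];
   [sum_sign_Pred] expresses this. *)
transitivity (\sum_(f : {ffun 'I_n -> X}) (order rotate f %| d)%:R *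
   (1 + \sum_(D : {set 'I_d} | (D != set0) && (D \subset Pred d))
     (-1) ^+ #|D| * (order rotate f %| gcd_set D)%:R) : rat)%R.
  under eq_bigl do rewrite inE.
  apply: eq_bigr => f _; case: (boolP (_ %| d)) => fd.
    by rewrite sum_sign_Pred // mul1r.
  by rewrite mul0r; case: eqP fd => // ->; rewrite dvdnn.
under [LHS]eq_bigr do rewrite mulrDr mulr1 mulr_sumr.
rewrite big_split /= fixE // exchange_big /=; congr (_ + _)%R.
apply: eq_bigr => D /andP[D0 DP]; have [i iD] := set0Pn _ D0.
(* Since [D] is nonempty, its gcd divides [d]; a period dividing the gcd then divides [d], so the
   product of the two indicators is the second one. *)
have Dd : gcd_set D %| d.
  apply: (biggcdn_inf i iD); have := subsetP DP i iD.
  by rewrite inE => /and3P[].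
rewrite -fixE ?(dvdn_trans Dd) // mulr_sumr; apply: eq_bigr => f _.
rewrite mulrCA; congr (_ * _)%R.
case: (boolP (_ %| gcd_set D)) => [h|]; last by rewrite mulr0.
by rewrite (dvdn_trans h Dd) mulr1.
Qed.

End Necklaces.

(** * Groups given by a bare operation *)

Section GroupFromOperation.
Variables (T : finType) (e : T) (op : T -> T -> T) (inv : T -> T).
Hypotheses (opA : associative op) (op1l : left_id e op) (op1r : right_id e op)
  (opVl : left_inverse e inv op) (opVr : right_inverse e inv op).

(** Packing the operation as a [finGroupType] gives access to Cauchy's theorem and to the cyclicity
    of groups of prime order. *)
Definition group_of_op : finGroupType :=
  HB.pack (Finite.sort T) (isGroup.Build T opA op1l op1r opVl opVr).
Local Notation G := group_of_op.

Let card_group_of_op : #|[set: G]| = #|T|.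
Proof. by rewrite cardsT; apply: (@bij_eq_card _ _ (id : G -> T)); exists id. Qed.

Lemma op_involution : 2 %| #|T| -> exists2 z, z != e & op z z = e.
Proof.
rewrite -card_group_of_op => G_even.
have [z _ oz] := @Cauchy G 2 [set: G]%G isT G_even.
exists z; first by rewrite -(@order_gt1 G z) oz.
by have := expg_order z; rewrite oz expgS expg1.
Qed.

Lemma op_Fp_iso p : prime p -> #|T| = p ->
  exists2 h : 'F_p -> T, bijective h & {morph h : x y / (x + y)%R >-> op x y}.
Proof.
rewrite -card_group_of_op => p_pr cardG.
have [g gE] : exists g : G, [set: G] = <[g]>%g.
  by apply/cyclicP; rewrite prime_cyclic // cardG.
have og : #[g]%g = p by rewrite orderE -gE.
exists (fun x : 'F_p => (g ^+ x)%g) => [|x y].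
  apply: inj_card_bij => [x y xy|]; last first.
    by rewrite card_Fp // -card_group_of_op cardG.
  have /eqP : (g ^+ x)%g = (g ^+ y)%g := xy.
  rewrite eq_expg_mod_order og !modn_small -?[X in _ < X](Fp_cast p_pr) ?ltn_ord //.
  by move/eqP/val_inj.
change ((g ^+ (x + y)%R)%g = (g ^+ x * g ^+ y)%g).
have -> : (x + y)%R = (x + y) %% p :> nat by congr (_ %% _); apply: Fp_cast.
by rewrite -expgD; apply/eqP; rewrite eq_expg_mod_order og modn_mod.
Qed.

End GroupFromOperation.

(** * The center of a loop and central quotients *)

Lemma centerP (T : finType) (op : T -> T -> T) (x : T) : reflect (forall y z,
    [/\ op x y = op y x, op (op x y) z = op x (op y z),
        op (op y x) z = op y (op x z) & op (op y z) x = op y (op z x)]) (x \in center op [set: T]).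
Proof.
rewrite inE in_setT /=; apply: (iffP forall_inP) => h y => [z|_].
  by have /forall_inP/(_ z (in_setT _))/and4P[] := h y (in_setT _); do 4 move/eqP->.
by apply/forall_inP => z _; have [<- <- <- <-] := h y z; rewrite !eqxx.
Qed.

Section LoopTheory.
Variables (T : finType) (op : T -> T -> T) (e : T).
Hypotheses (opL : is_loop op) (e_neutral : neutral op e).
Local Infix "*" := op.
Local Notation Z := (center op [set: T]).

Let mul1 x : e * x = x. Proof. by case: (e_neutral x). Qed.
Let mulr1 x : x * e = x. Proof. by case: (e_neutral x). Qed.
Lemma loop_mulI x : injective (op x).
Proof. by case: opL => _ h _; apply: bij_inj. Qed.
Lemma loop_mulIr x : injective (op^~ x).
Proof. by case: opL => _ _ h; apply: bij_inj. Qed.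

Lemma centerC x y : x \in Z -> x * y = y * x.
Proof. by move/centerP/(_ y y) => []. Qed.

(** With [centerAC], this moves central factors to the right end of a product, the normal form used
    in the computations below. *)
Lemma centerAr x y c : c \in Z -> x * (y * c) = (x * y) * c.
Proof. by move/centerP/(_ x y) => []. Qed.

Lemma centerAC x y c : c \in Z -> (x * c) * y = (x * y) * c.
Proof.
move=> cZ; rewrite -(centerAr x y cZ) -[y * c]centerC //.
by move/centerP: cZ => /(_ x y)[].
Qed.


Lemma center1 : e \in Z.
Proof. by apply/centerP => y z; rewrite !mul1 !mulr1. Qed.

Lemma centerM c d : c \in Z -> d \in Z -> c * d \in Z.
Proof.
move=> cZ dZ.
have cdE y : (c * d) * y = (y * c) * d by rewrite centerAC // (centerC y cZ).
have ycdE y : y * (c * d) = (y * c) * d by rewrite centerAr.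
apply/centerP => y z; split; rewrite ?cdE ?ycdE //.
- by rewrite (centerAC _ _ dZ) (centerAC _ _ cZ).
- by rewrite (centerAC _ _ dZ) (centerAC _ _ cZ) (centerAr _ _ dZ) (centerAr _ _ cZ).
- by rewrite (centerAr _ _ dZ) (centerAr _ _ cZ).
Qed.

(** Left translation by [x] maps the finite set [Z] injectively into itself, hence onto itself. *)
Lemma center_finv x y : x \in Z -> y \in Z -> exists2 c, c \in Z & x * c = y.
Proof.
move=> xZ yZ; suff: y \in [set x * c | c in Z] by move=> /imsetP[c cZ ->]; exists c.
have /eqP-> // : [set x * c | c in Z] == Z.
rewrite eqEcard card_imset ?leqnn ?andbT; last exact: loop_mulI.
by apply/subsetP => _ /imsetP[c cZ ->]; apply: centerM.
Qed.

Section CentralQuotient.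
Variable N : {set T}.
Hypotheses (NZ : N \subset Z) (N1 : e \in N)
  (NM : {in N &, forall x y, x * y \in N}).
Local Notation coset := (lcoset_of op N).

Let inZ c : c \in N -> c \in Z. Proof. exact: (subsetP NZ). Qed.

Lemma card_lcoset x : #|coset x| = #|N|.
Proof. by rewrite card_imset //; apply: loop_mulI. Qed.

Lemma lcoset_eq x y : (coset x == coset y) = (y \in coset x).
Proof.
apply/eqP/idP => [->|/imsetP[c cN ->]].
  by have := imset_f (op y) N1; rewrite mulr1.
apply/esym/eqP; rewrite eqEcard !card_lcoset leqnn andbT.
apply/subsetP => _ /imsetP[d dN ->].
by rewrite -centerAr ?inZ // imset_f ?NM.
Qed.

Lemma quotient_opE x y : quotient_op op (coset x) (coset y) = coset (x * y).
Proof.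
apply/setP => w; apply/imset2P/imsetP.
  move=> [_ _ /imsetP[c cN ->] /imsetP[d dN ->] ->]; exists (c * d); rewrite ?NM //.
  have [cZ dZ] := (inZ cN, inZ dN).
  by rewrite (centerAr (x * c) y dZ) (centerAr (x * y) c dZ) (centerAC x y cZ).
move=> [c cN ->]; exists x (y * c); rewrite ?imset_f //.
  by apply/imsetP; exists e; rewrite ?mulr1.
by rewrite centerAr ?inZ.
Qed.

(** The cosets as a [finType], so that results on loops carried by a whole type apply to the
    quotient. *)
Definition quotient_type := {B : {set T} | B \in quotient_carrier op N}.

Definition quotient_pi x : quotient_type :=
  Sub (coset x) (imset_f (lcoset_of op N) (in_setT x)).
Local Notation pi := quotient_pi.

(** The default [A] is never returned here: by [quotient_opE] a product of cosets is a coset. *)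
Definition quotient_mul (A B : quotient_type) : quotient_type :=
  insubd A (quotient_op op (val A) (val B)).

Lemma quotient_piP A : exists x, A = pi x.
Proof.
by have /imsetP[x _ E] := valP A; exists x; apply: val_inj; rewrite E.
Qed.

Lemma quotient_piM x y : pi (x * y) = quotient_mul (pi x) (pi y).
Proof.
apply: val_inj; rewrite val_insubd /= quotient_opE ifT //.
by apply: imset_f; rewrite inE.
Qed.

Lemma quotient_pi_eq x y : (pi x == pi y) = (y \in coset x).
Proof. by rewrite -val_eqE /= lcoset_eq. Qed.

Lemma quotient_mul_loop : is_loop quotient_mul.
Proof.
split.
- exists (pi e) => A; have [x ->] := quotient_piP A.
  by rewrite -!quotient_piM mul1 mulr1.
- move=> A; apply: injF_bij => B C; have [x ->] := quotient_piP A.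
  have [y ->] := quotient_piP B; have [w ->] := quotient_piP C.
  move/eqP; rewrite -!quotient_piM quotient_pi_eq => /imsetP[c cN].
  rewrite -centerAr ?inZ // => /loop_mulI ->; apply/eqP.
  by rewrite quotient_pi_eq imset_f.
- move=> A; apply: injF_bij => B C; have [x ->] := quotient_piP A.
  have [y ->] := quotient_piP B; have [w ->] := quotient_piP C.
  move/eqP; rewrite -!quotient_piM quotient_pi_eq => /imsetP[c cN].
  rewrite -centerAC ?inZ // => /loop_mulIr ->; apply/eqP.
  by rewrite quotient_pi_eq imset_f.
Qed.

Lemma quotient_neutral : neutral quotient_mul (pi e).
Proof.
by move=> A; have [x ->] := quotient_piP A; rewrite -!quotient_piM mul1 mulr1.
Qed.

Lemma card_quotient_type : #|T| = (#|{: quotient_type}| * #|N|)%N.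
Proof.
rewrite -cardsT -sum1_card (partition_big_imset pi) /= -sum_nat_const.
have piT : [set pi x | x in [set: T]] = [set: quotient_type].
  by apply/setP => A; have [x ->] := quotient_piP A; rewrite imset_f !inE.
rewrite piT; apply: eq_big => A; rewrite ?inE // => _.
have [x ->] := quotient_piP A; rewrite -(card_lcoset x) -sum1_card.
by apply: eq_bigl => y; rewrite inE eq_sym quotient_pi_eq.
Qed.

(** Links the center of a set of subsets, which occurs in [upper_central], with the center of the
    loop on [quotient_type]. *)
Lemma center_quotient x :
  (coset x \in center (quotient_op op) (quotient_carrier op N)) =
  (pi x \in center quotient_mul [set: quotient_type]).
Proof.
have piE u v : (coset u == coset v) = (pi u == pi v) by rewrite -val_eqE.
rewrite !inE imset_f ?inE //=; apply/forall_inP/forall_inP => h A.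
- have [y ->] := quotient_piP A => _; apply/forall_inP => B _.
  have [w ->] := quotient_piP B; have := h (coset y) (imset_f _ (in_setT y)).
  move/forall_inP/(_ (coset w) (imset_f _ (in_setT w))).
  by rewrite -!quotient_piM !quotient_opE !piE.
- move=> /imsetP[y _ ->]; apply/forall_inP => _ /imsetP[w _ ->].
  have /forall_inP/(_ (pi w) (in_setT _)) := h (pi y) (in_setT _).
  by rewrite -!quotient_piM !quotient_opE !piE.
Qed.

Lemma quotient_centerP x : reflect (forall y z,
    [/\ pi (x * y) = pi (y * x), pi ((x * y) * z) = pi (x * (y * z)),
        pi ((y * x) * z) = pi (y * (x * z)) & pi ((y * z) * x) = pi (y * (z * x))])
  (pi x \in center quotient_mul [set: quotient_type]).
Proof.
apply: (iffP (centerP _ _)) => h y z.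
  by rewrite !quotient_piM; apply: h.
have [u ->] := quotient_piP y; have [w ->] := quotient_piP z.
by rewrite -!quotient_piM; apply: h.
Qed.

End CentralQuotient.

Lemma upper_central0 : upper_central op 0 = [set e].
Proof.
apply/setP => x; rewrite !inE; apply/asboolP/eqP => [xn|->//].
by have [<- _] := xn e; rewrite mulr1.
Qed.

Lemma upper_central1 : upper_central op 1 = Z.
Proof.
have eZ : [set e] \subset Z by rewrite sub1set center1.
have e1 : e \in [set e] by rewrite inE.
have eM : {in [set e] &, forall x y, x * y \in [set e]}.
  by move=> _ _ /set1P-> /set1P->; rewrite mulr1 inE.
(* The quotient by the trivial subloop is a copy of the loop itself. *)
have pi_inj : injective (quotient_pi [set e]).
  move=> x y /eqP; rewrite quotient_pi_eq // => /imsetP[_ /set1P-> ->].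
  by rewrite mulr1.
have /= := upper_central0 => /= ->.
apply/setP => x; rewrite inE center_quotient //.
apply/quotient_centerP/centerP => // h y z; last by have [-> -> -> ->] := h y z.
by split; apply: pi_inj; have [] := h y z.
Qed.

Lemma upper_central_stable j k :
  upper_central op j.+1 = upper_central op j ->
  upper_central op (k + j) = upper_central op j.
Proof. by move=> jE; elim: k => // k IHk; rewrite addSn -[RHS]jE /= IHk. Qed.

(** Once two consecutive terms agree the series is constant, so it cannot reach the whole loop after
    step [j]; the first hypothesis excludes the earlier steps. *)
Lemma nilpotentN j :
  (forall i, i <= j -> upper_central op i != [set: T]) ->
  upper_central op j.+1 = upper_central op j -> ~ nilpotent op.
Proof.
move=> jT jE [n nT]; have [/jT|/ltnW le_jn] := leqP n j; first by rewrite nT eqxx.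
by have := jT j (leqnn j); rewrite -(upper_central_stable (n - j) jE) subnK // nT eqxx.
Qed.

Lemma card_center_dvdn : #|Z| %| #|T|.
Proof. by rewrite (card_quotient_type (subxx Z) center1 centerM) dvdn_mull. Qed.

(* If Q = Z u tZ, then t * t is in Z, and moving all central factors to the right
   reduces every instance of the laws for t to the one with y = z = t. *)
Lemma card_neq_double_center : #|T| <> (2 * #|Z|)%N.
Proof.
move=> cardT; have Z_gt0 : 0 < #|Z| by apply/card_gt0P; exists e; apply: center1.
have /subsetPn[t _ tNZ] : ~~ ([set: T] \subset Z).
  by apply/negP => /subset_leq_card; rewrite cardsT cardT; lia.
pose tZ := [set t * c | c in Z].
have disj x : x \in Z -> x \notin tZ.
  move=> xZ; apply: contra tNZ => /imsetP[c cZ xE].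
  have [d dZ] := center_finv cZ xZ.
  by rewrite xE centerC // => /loop_mulIr <-.
have cover x : (x \in Z) || (x \in tZ).
  have: x \in Z :|: tZ.
    suff /eqP-> : Z :|: tZ == [set: T] by [].
    rewrite eqEcard subsetT cardsT cardT cardsU.
    rewrite [#|tZ|]card_imset; last exact: loop_mulI.
    rewrite (_ : Z :&: tZ = set0) ?cards0; first by lia.
    apply/setP => y; rewrite !inE; apply/negbTE/negP => /andP[yZ].
    by apply/negP/disj; rewrite inE in_setT.
  by rewrite in_setU.
have ttZ : t * t \in Z.
  have /orP[//|/imsetP[c cZ /loop_mulI tc]] := cover (t * t).
  by rewrite tc cZ in tNZ.
case/negP: tNZ; apply/centerP => y z.
have [yZ|/imsetP[c cZ ->]] := orP (cover y).
  split; first by rewrite (centerC t yZ).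
  - by move/centerP: yZ => /(_ t z)[].
  - by move/centerP: yZ => /(_ t z)[].
  - by move/centerP: yZ => /(_ z t)[].
have [zZ|/imsetP[d dZ ->]] := orP (cover z).
  split; first by rewrite (centerAr _ _ cZ) (centerAC _ _ cZ).
  - by rewrite !(centerAr _ _ zZ).
  - by rewrite centerAr.
  - by rewrite (centerAC _ _ zZ) (centerC t zZ) (centerAr _ _ zZ).
have tttE : (t * t) * t = t * (t * t) by rewrite (centerC t ttZ).
have R1 u v : u * (v * c) = u * v * c by apply: centerAr.
have R2 u v : u * c * v = u * v * c by apply: centerAC.
have R3 u v : u * (v * d) = u * v * d by apply: centerAr.
have R4 u v : u * d * v = u * v * d by apply: centerAC.
by split; rewrite ?(R3, R4) ?(R1, R2) ?tttE.
Qed.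

(** * Loops equal to their center are abelian groups *)

Section FullCenter.
Hypothesis fullZ : Z = [set: T].
Let inZ x : x \in Z. Proof. by rewrite fullZ inE. Qed.

Let inv x := finv (op x) e.
Let mulA : associative op. Proof. by move=> x y z; rewrite centerAr. Qed.
Let mulVr : right_inverse e inv op.
Proof. by move=> x; rewrite /inv f_finv //; apply: loop_mulI. Qed.
Let mulVl : left_inverse e inv op.
Proof. by move=> x; rewrite centerC // mulVr. Qed.

Lemma full_center_involution : 2 %| #|T| -> exists2 z, z != e & z * z = e.
Proof. exact: op_involution mulA mul1 mulr1 mulVl mulVr. Qed.

Lemma full_center_Fp_iso p : prime p -> #|T| = p ->
  exists2 h : 'F_p -> T, bijective h & {morph h : x y / (x + y)%R >-> x * y}.
Proof. exact: (op_Fp_iso mulA mul1 mulr1 mulVl mulVr). Qed.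

End FullCenter.

End LoopTheory.

(** * Central extensions by the group [bool] of order 2 *)

(** Loops need not be associative, so no cocycle identity is imposed on [theta]. *)
Definition extension_op (F : zmodType) (theta : F -> F -> bool) (u v : F * bool) :=
  ((u.1 + v.1)%R, u.2 (+) v.2 (+) theta u.1 v.1).

(** The first two conditions make [(0, false)] neutral; the third says that doubling [(x, false)]
    gives [(x + x, false)]. *)
Definition normalized (F : zmodType) (theta : F -> F -> bool) :=
  forall x y, [/\ theta 0%R y = false, theta x 0%R = false & theta x x = false].

(** * Nilpotent loops of order 2q are extensions *)

Section NilpotentOrder2q.
Variables (T : finType) (op : T -> T -> T) (e : T) (q : nat).
Hypotheses (opL : is_loop op) (e_neutral : neutral op e).
Hypotheses (q_pr : prime q) (q_odd : odd q) (cardT : #|T| = (2 * q)%N).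
Local Infix "*" := op.
Local Notation Z := (center op [set: T]).

Let mul1 x : e * x = x. Proof. by case: (e_neutral x). Qed.
Let mulr1 x : x * e = x. Proof. by case: (e_neutral x). Qed.
Let Z1 : e \in Z. Proof. exact: center1 e_neutral. Qed.
Let ZM : {in Z &, forall x y, x * y \in Z}. Proof. exact: centerM. Qed.

(* The order of Z divides 2q and is neither 1 nor q.  If it is 2q, Cauchy's theorem
   gives z; if it is 2, the centre of Q/Z is nontrivial in the prime order q. *)
Lemma nilpotent_central_involution : nilpotent op ->
  exists z, [/\ z \in Z, z != e, z * z = e &
    center (@quotient_mul T op [set e; z]) [set: quotient_type op [set e; z]] = [set: _]].
Proof.
move=> nilT; have q_gt0 := prime_gt0 q_pr.
have q_gt2 : 2 < q by case: (q) q_pr q_odd => [|[|[|]]].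
have cardTP (A : {set T}) : #|A| != #|T| -> A != [set: T].
  by apply: contraNneq => ->; rewrite cardsT.
have up0 : upper_central op 0 != [set: T].
  by rewrite (upper_central0 e_neutral); apply: cardTP; rewrite cards1 cardT; lia.
have Z_neq1 : Z <> [set e].
  rewrite -(upper_central1 opL e_neutral) -(upper_central0 e_neutral) => up1.
  by case: (@nilpotentN _ _ 0 _ up1 nilT) => -[].
have Z_gt1 : 1 < #|Z|.
  rewrite ltn_neqAle card_gt0 andbC; apply/andP; split.
    by apply/set0Pn; exists e; apply: Z1.
  apply/eqP => /esym/eqP/cards1P[x Zx].
  by case: Z_neq1; rewrite Zx; have := Z1; rewrite Zx => /set1P->.
have full_quotient (N : {set T}) : N \subset Z -> Z = [set: T] -> e \in N ->
    {in N &, forall x y, x * y \in N} ->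
    center (@quotient_mul T op N) [set: quotient_type op N] = [set: _].
  move=> NZ fullZ N1 NM; apply/setP => A; rewrite [RHS]inE.
  have [x ->] := quotient_piP A; apply/(quotient_centerP e_neutral) => // y z.
  have /centerP/(_ y z)[-> -> -> ->] // : x \in Z by rewrite fullZ inE.
have pairM z : z * z = e -> {in [set e; z] &, forall x y, x * y \in [set e; z]}.
  by move=> zz _ _ /set2P[->|->] /set2P[->|->]; rewrite ?mul1 ?mulr1 ?zz !inE eqxx ?orbT.
have [fullZ|nfullZ] := eqVneq Z [set: T].
  have [|z ze zz] := full_center_involution opL e_neutral fullZ.
    by rewrite cardT dvdn_mulr.
  exists z; split => //; first by rewrite fullZ inE.
  apply: full_quotient => //; rewrite ?fullZ ?subsetT ?inE ?eqxx //.
  exact: pairM.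
have [k cardZ] := dvdnP (card_center_dvdn opL e_neutral).
have cardZ2 : #|Z| = 2.
  rewrite cardT in cardZ.
  have : q %| (k * #|Z|)%N by rewrite -cardZ dvdn_mull.
  rewrite Euclid_dvdM //.
  have Z_lt : #|Z| < (2 * q)%N.
    by rewrite -cardT -cardsT ltn_neqAle subset_leq_card ?subsetT ?andbT //;
       apply: contra nfullZ => /eqP h; rewrite eqEcard subsetT h leqnn.
  (* If [q] divides the index [k], then [#|Z|] divides 2 and exceeds 1. If [q] divides [#|Z|], then
     [#|Z| = q], which [card_neq_double_center] forbids. *)
  move=> /orP[/dvdnP[j jE]|/dvdnP[j jE]].
    move: cardZ; rewrite jE -mulnA mulnCA mulnC => /eqP.
    rewrite eqn_pmul2l // => /eqP jZ.
    by case: j jZ {jE} => [|[|j]]; nia.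
  move: Z_lt Z_gt1; rewrite jE ltn_pmul2r //; case: j jE => [|[|j]] // jE _ _.
  by case: (card_neq_double_center opL e_neutral); rewrite cardT jE mul1n.
have [z zZ ze] : exists2 z, z \in Z & z != e.
  by have /card_gt1P[x [y [xZ yZ xy]]] := Z_gt1; case: (eqVneq x e) xy => [-> ye|xe];
   [exists y; rewrite // eq_sym | exists x].
have ZE : Z = [set e; z].
  apply/esym/eqP; rewrite eqEcard cardZ2 cards2 eq_sym ze andbT.
  by apply/subsetP => _ /set2P[->|->]; rewrite ?Z1.
have zz : z * z = e.
  have : z * z \in Z by apply: ZM.
  rewrite ZE => /set2P[//|/esym/eqP]; rewrite -{1}[z]mulr1 (inj_eq (@loop_mulI T op opL z)).
  by rewrite eq_sym (negPf ze).
exists z; split => //; rewrite -ZE.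
have qL := quotient_mul_loop opL e_neutral (subxx Z) Z1 ZM.
have qN := quotient_neutral e_neutral (subxx Z) Z1 ZM.
have cardQ : #|{: quotient_type op Z}| = q.
  have := card_quotient_type opL e_neutral (subxx Z) Z1 ZM.
  by rewrite cardT cardZ2; lia.
have pi_in (x : T) : (quotient_pi op Z x \in center (@quotient_mul T op Z) [set: _]) =
    (x \in upper_central op 2).
  rewrite -(center_quotient e_neutral (subxx Z) Z1 ZM).
  by rewrite -[in LHS](upper_central1 opL e_neutral) /= inE.
(* The center of the quotient has order 1 or [q]. Order 1 would make the second term of the series
   equal to the first, against nilpotency. *)
have := card_center_dvdn qL qN; rewrite [X in _ %| X]cardQ => /(primeP q_pr).2.
case/orP => /eqP cardC; last first.
  by apply/eqP; rewrite eqEcard subsetT cardsT cardQ cardC leqnn.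
have [w cE] : exists w, center (@quotient_mul T op Z) [set: _] = [set w].
  by apply/cards1P/eqP.
have piw : quotient_pi op Z e = w.
  by apply/eqP; rewrite -in_set1 -cE; apply: center1 qN.
case: (@nilpotentN _ op 1 _ _ nilT) => [[|[|//]] _|] //.
  by rewrite (upper_central1 opL e_neutral).
apply/setP => x; rewrite -pi_in cE (upper_central1 opL e_neutral) in_set1 -piw.
rewrite eq_sym (quotient_pi_eq opL e_neutral (subxx Z) Z1 ZM).
apply/imsetP/idP => [[c cZ ->]|xZ]; first by rewrite mul1.
by exists x; rewrite ?mul1.
Qed.

Lemma Fp_two_neq0 : (2%:R != 0 :> 'F_q)%R.
Proof.
rewrite -(dvdn_pcharf (pchar_Fp q_pr)) gtnNdvd //.
by case: (q) q_pr q_odd => [|[|[|]]].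
Qed.

(* The representatives s are chosen with s (x + x) = s x * s x, which is possible
   because squaring is constant on the cosets of {e, z}; this makes the cocycle
   vanish on the diagonal. *)
Lemma nilpotent_extension : nilpotent op ->
  exists2 theta : 'F_q -> 'F_q -> bool,
    normalized theta & isomorphic (extension_op theta) op.
Proof.
move=> /nilpotent_central_involution[z [zZ ze zz]]; set N := [set e; z] => fullQ.
have NZ : N \subset Z by apply/subsetP => _ /set2P[->|->].
have N1 : e \in N by rewrite !inE eqxx.
have NM : {in N &, forall x y, x * y \in N}.
  by move=> _ _ /set2P[->|->] /set2P[->|->]; rewrite ?mul1 ?mulr1 ?zz !inE eqxx ?orbT.
have qL := quotient_mul_loop opL e_neutral NZ N1 NM.
have qN := quotient_neutral e_neutral NZ N1 NM.
have piM := quotient_piM e_neutral NZ N1 NM.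
have pi_eq := quotient_pi_eq opL e_neutral NZ N1 NM.
have cardQ : #|{: quotient_type op N}| = q.
  have := card_quotient_type opL e_neutral NZ N1 NM.
  by rewrite cardT cards2 eq_sym ze; lia.
have [h hB hM] := full_center_Fp_iso qL qN fullQ q_pr cardQ.
pose pi := quotient_pi op N.
have h0 : h 0%R = pi e.
  have [h' _ h'K] := hB; rewrite -(h'K (pi e)) -[in RHS](addr0 (h' _)) hM h'K.
  by case: (qN (h 0%R)).
have [r rP] : exists r : 'F_q -> T, forall x, pi (r x) = h x.
  apply: (@fin_all_exists _ (fun=> T) (fun x y => pi y = h x)) => x.
  by have [y ->] := quotient_piP (h x); exists y.
(* If [u = v * c] with [c] in [N], then [u * u = (v * v) * (c * c)], and [c * c = e]. *)
have sqE u v : pi u = pi v -> u * u = v * v.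
  move/eqP; rewrite pi_eq => /imsetP[c cN ->].
  have cZ := subsetP NZ c cN.
  rewrite (centerAr _ _ cZ) (centerAC _ _ cZ) -(centerAr _ _ cZ).
  by case/set2P: cN => ->; rewrite ?zz ?mulr1.
(* [s x] is the square of a lift of x/2; by [sqE] it does not depend on the lift. *)
pose s x := let w := r (x / 2%:R)%R in w * w.
have half_double x : (x / 2%:R + x / 2%:R = x :> 'F_q)%R.
  by rewrite -mulrDl -mulr2n -[(x *+ 2)%R]mulr_natr mulfK // Fp_two_neq0.
have sP x : pi (s x) = h x by rewrite /pi piM -/pi rP -hM half_double.
have s0 : s 0%R = e by rewrite /s mul0r (sqE _ e) ?mulr1 // rP.
(* Both sides are squares of lifts of [x]. *)
have sD x : s (x + x)%R = s x * s x.
  by apply: sqE; rewrite rP sP -[in RHS](half_double x) mulrDl.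
pose zb (b : bool) := if b then z else e.
have zbN b : zb b \in N by case: b; rewrite !inE eqxx ?orbT.
have zbZ b : zb b \in Z by apply: (subsetP NZ).
have zbM u a b : u * zb a * zb b = u * zb (a (+) b).
  rewrite -centerAr //; congr (_ * _).
  by case: a; case: b; rewrite /= ?mul1 ?mulr1 ?zz.
have uz u : (u * z == u) = false.
  by rewrite -{2}[u]mulr1 (inj_eq (@loop_mulI _ _ opL _)) (negPf ze).
(* The two elements lie in one coset of [N]; [theta x y] records whether they differ by [z]. *)
pose theta x y := s x * s y != s (x + y)%R.
have thetaP x y : s x * s y = s (x + y)%R * zb (theta x y).
  have : pi (s (x + y)%R) == pi (s x * s y) by rewrite /pi piM -/pi !sP hM.
  rewrite /theta pi_eq => /imsetP[c /set2P[->|->] ->]; rewrite ?mulr1 ?eqxx ?mulr1 //.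
  by rewrite uz.
exists theta => [x y|].
  by rewrite /theta s0 mul1 mulr1 add0r addr0 sD !eqxx.
exists (fun u : 'F_q * bool => s u.1 * zb u.2).
  apply: inj_card_bij; last by rewrite cardT card_prod card_Fp // card_bool mulnC.
  move=> [x a] [y b] /= E.
  have piE u c : pi (s u * zb c) = h u.
    by rewrite -sP; apply/esym/eqP; rewrite pi_eq imset_f.
  have xy : x = y by apply: (bij_inj hB); rewrite -(piE x a) E piE.
  move: E; rewrite xy => /loop_mulI; case: a; case: b => //= /(_ opL) /eqP.
    by rewrite (negPf ze).
  by rewrite eq_sym (negPf ze).
move=> [x a] [y b] /=.
rewrite (centerAr _ _ (zbZ b)) (centerAC _ _ (zbZ a)) thetaP !zbM.
by congr (_ * zb _); rewrite addbC addbA addbC.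
Qed.

End NilpotentOrder2q.
Lemma isomorphic_sym (T1 T2 : finType) (op1 : T1 -> T1 -> T1) (op2 : T2 -> T2 -> T2) :
  isomorphic op1 op2 -> isomorphic op2 op1.
Proof.
move=> [f [g fK gK] fM]; exists g; first by exists f.
by move=> x y; apply: (can_inj fK); rewrite fM !gK.
Qed.

Lemma isomorphic_trans (T1 T2 T3 : finType) (op1 : T1 -> T1 -> T1)
    (op2 : T2 -> T2 -> T2) (op3 : T3 -> T3 -> T3) :
  isomorphic op1 op2 -> isomorphic op2 op3 -> isomorphic op1 op3.
Proof.
move=> [f fB fM] [g gB gM]; exists (g \o f); first exact: bij_comp.
by move=> x y /=; rewrite fM gM.
Qed.

(** * Extensions are nilpotent loops *)

Section ExtensionNilpotent.
Variables (F : finZmodType) (theta : F -> F -> bool).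
Variables (T : finType) (op : T -> T -> T).
Hypotheses (thetaN : normalized theta) (iso : isomorphic op (extension_op theta)).
Local Infix "*" := op.
Local Notation Z := (center op [set: T]).

Let theta0l y : theta 0%R y = false. Proof. by case: (thetaN 0%R y). Qed.
Let theta0r x : theta x 0%R = false. Proof. by case: (thetaN x 0%R). Qed.

Lemma extension_loop : is_loop op.
Proof.
have [g [g' gK g'K] gM] := iso; have gI := can_inj gK; split.
- exists (g' (0%R, false)) => x; split; apply: gI; rewrite gM g'K;
    case: (g x) => y a; rewrite /extension_op /= ?add0r ?addr0 ?theta0l ?theta0r //;
    by rewrite !addbF.
- move=> x; apply: injF_bij => y y' /(congr1 g); rewrite !gM => -[/addrI E1 E2].
  apply: gI; move: E1 E2; case: (g y) (g y') => [v b] [v' b'] /= -> /addIb.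
  by move/addbI ->.
- move=> x; apply: injF_bij => y y' /(congr1 g); rewrite !gM => -[/addIr E1 E2].
  apply: gI; move: E1 E2; case: (g y) (g y') => [v b] [v' b'] /= -> /addIb.
  by move/addIb ->.
Qed.

(** Elements with first component 0 are central, so a coset of [Z] is determined by a first
    component. First components add in an abelian group, hence the second term of the series is the
    whole loop. *)
Lemma extension_nilpotent : nilpotent op.
Proof.
have opL := extension_loop; have [[e eN] _ _] := opL.
have [g [g' gK g'K] gM] := iso; have gI := can_inj gK.
have central c : (g c).1 = 0%R -> c \in Z.
  case E: (g c) => [v b] /= v0; move: E; rewrite {}v0 => gc.
  apply/centerP => x y; split; apply: gI; rewrite !gM gc /extension_op /=.
  - by rewrite add0r addr0 theta0l theta0r; case: b gc; case: (g x).2.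
  - by rewrite !add0r !theta0l !addbF !addbA.
  - by rewrite addr0 theta0r add0r theta0l !addbF !addbA.
  - by rewrite !addr0 !theta0r !addbF !addbA; congr (_, _); rewrite addbAC.
have [Z1 ZM] := (center1 eN, @centerM T op).
have piE := quotient_pi_eq opL eN (subxx Z) Z1 ZM.
have pi_fst x y : (g x).1 = (g y).1 -> quotient_pi op Z x = quotient_pi op Z y.
  move=> xy; apply/eqP; rewrite piE; apply/imsetP.
  exists (g' (0%R, (g x).2 (+) (g y).2)); first by apply: central; rewrite g'K.
  apply: gI; rewrite gM g'K [g y]surjective_pairing -xy /extension_op /= addr0 theta0r.
  by rewrite addbF addKb.
exists 2; rewrite -[2]/(1.+1) /=.
have /= -> := upper_central1 opL eN; apply/setP => x.
rewrite [RHS]inE inE (center_quotient eN (subxx Z) Z1 ZM).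
apply/(quotient_centerP eN (subxx Z) Z1 ZM) => y w.
by split; apply: pi_fst; rewrite !gM /= ?addrA // addrC.
Qed.

End ExtensionNilpotent.

(** * Isomorphisms between extensions *)

Section ExtensionIso.
Variables (q : nat) (q_pr : prime q) (q_odd : odd q).
Variables (theta mu : 'F_q -> 'F_q -> bool).
Hypotheses (thetaN : normalized theta) (muN : normalized mu).

(* (0, true) is the only non-neutral element of square (0, false), hence fixed by
   every isomorphism; evaluating at (x / 2, x / 2) then shows that the correction
   term of the second component vanishes. *)
Lemma extension_isoP : isomorphic (extension_op theta) (extension_op mu) <->
  exists2 u : 'F_q, u != 0%R & forall x y, theta x y = mu (u * x)%R (u * y)%R.
Proof.
have two_neq0 := Fp_two_neq0 q_pr q_odd.
have [theta0l theta0r thetaxx] : [/\ forall y, theta 0%R y = false,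
    forall x, theta x 0%R = false & forall x, theta x x = false].
  by split=> x; case: (thetaN 0%R x) (thetaN x 0%R) => ? _ _ [].
have [mu0l mu0r muxx] : [/\ forall y, mu 0%R y = false,
    forall x, mu x 0%R = false & forall x, mu x x = false].
  by split=> x; case: (muN 0%R x) (muN x 0%R) => ? _ _ [].
split=> [[f fB fM]|[u u0 uE]]; last first.
  (* Scaling the first component realizes the given relation between cocycles. *)
  exists (fun w => (u * w.1, w.2)%R).
    exists (fun w => (u^-1 * w.1, w.2)%R) => -[x a] /=; first by rewrite mulKf.
    by rewrite mulVKf.
  by move=> [x a] [y b] /=; rewrite /extension_op /= uE mulrDr.
have f0 : f (0, false)%R = (0, false)%R.
  have := fM (0, false)%R (0, false)%R; rewrite {1}/extension_op /= addr0 theta0l /=.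
  case: (f _) => x a; rewrite /extension_op /= => -[/eqP].
  rewrite -[X in X == _]addr0 (inj_eq (addrI x)) => /eqP <-.
  by rewrite mu0l addbb => ->.
have [z fz] : exists z, f (0, true)%R = (0, z)%R.
  have := fM (0, true)%R (0, true)%R; rewrite {1}/extension_op /= addr0 theta0l /= f0.
  case: (f _) => x z /(congr1 fst)/esym/eqP.
  rewrite -[_.1]/(x + x)%R -mulr2n -mulr_natr mulf_eq0 (negPf two_neq0) orbF => /eqP ->.
  by exists z.
have {z} fz : f (0, true)%R = (0, true)%R.
  case: z fz => // fz; have := bij_inj fB; move=> /(_ (0, true)%R (0, false)%R).
  by rewrite fz f0 => /(_ erefl).
have fE x a : f (x, a) = ((f (x, false)).1, (f (x, false)).2 (+) a).
  case: a; last by rewrite addbF -surjective_pairing.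
  have -> : (x, true) = extension_op theta (x, false) (0%R, true).
    by rewrite /extension_op /= addr0 theta0r.
  by rewrite fM fz /extension_op /= addr0 mu0r addbF.
pose al x := (f (x, false)).1; pose ta x := (f (x, false)).2.
have fD x y : f ((x + y)%R, theta x y) =
    ((al x + al y)%R, ta x (+) ta y (+) mu (al x) (al y)).
  have := fM (x, false) (y, false); rewrite {1}/extension_op /= => ->.
  by [].
have alD x y : al (x + y)%R = (al x + al y)%R.
  by have := congr1 fst (fD x y); rewrite fE.
have taD x y : ta (x + y)%R (+) theta x y = ta x (+) ta y (+) mu (al x) (al y).
  by have := congr1 snd (fD x y); rewrite fE.
have ta_0 x : ta x = false.
  have := taD (x / 2%:R)%R (x / 2%:R)%R; rewrite thetaxx muxx addbb !addbF.
  by rewrite -mulrDl -mulr2n -[(x *+ 2)%R]mulr_natr mulfK.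
have al0 : al 0%R = 0%R by rewrite /al f0.
(* An additive map of ['F_q] is multiplication by its value at 1. *)
have alE x : al x = (al 1 * x)%R.
  rewrite -[x]natr_Zp; elim: (x : nat) => [|k IHk]; first by rewrite al0 mulr0.
  by rewrite -!natr1 alD IHk mulrDr mulr1.
exists (al 1%R) => [|x y]; last by have := taD x y; rewrite !ta_0 -!alE.
(* If [al 1] were 0, [f] would identify [(1, false)] with [(0, false)]. *)
apply/eqP => al1; have := bij_inj fB; move=> /(_ (1, false)%R (0, false)%R).
rewrite f0 [f _]surjective_pairing -/(al _) -/(ta _) al1 ta_0 => /(_ erefl) [] /eqP.
by rewrite oner_eq0.
Qed.

End ExtensionIso.

(** * Cocycles as colorings indexed by powers of a primitive root *)

Lemma Fp_expf_pred q (x : 'F_q) : prime q -> x != 0%R -> (x ^+ (q - 1) = 1)%R.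
Proof.
move=> q_pr x0; apply: (mulfI x0); have := expf_card x; rewrite card_Fp // => xq.
by rewrite -exprS subn1 prednK ?prime_gt0 // mulr1.
Qed.

Lemma Fp_primitive_root q : prime q ->
  exists g : 'F_q, ((q - 1).-primitive_root g)%R.
Proof.
move=> q_pr; have q_gt1 := prime_gt1 q_pr.
have size_rs : size (enum [pred x : 'F_q | x != 0%R]) = (q - 1)%N.
  have := cardC1 (0%R : 'F_q); rewrite card_Fp // subn1 -cardE => <-.
  exact: eq_card.
have /hasP[g _ g_prim] : has (q - 1).-primitive_root%R (enum [pred x : 'F_q | x != 0%R]).
  apply: has_prim_root; rewrite ?subn_gt0 ?enum_uniq ?size_rs //.
  apply/allP => x; rewrite mem_enum inE unity_rootE => x0.
  by rewrite Fp_expf_pred.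
by exists g.
Qed.

Section Colorings.
Variables (q : nat) (q_pr : prime q) (q_odd : odd q) (g : 'F_q).
Hypothesis g_prim : ((q - 1).-primitive_root g)%R.

Definition ratio := {c : 'F_q | (c != 0%R) && (c != 1%R)}.
Local Notation X := {ffun ratio -> bool}.
Implicit Types (f : {ffun 'I_(q - 1) -> X}) (c : 'F_q).

(* On a nonzero x = g ^+ i the cocycle at (x, y) is read off at c = y / x; the
   excluded values c = 0 and c = 1, and x = 0, give false. *)
Definition color (s : X) c : bool := if insub c is Some c' then s c' else false.

Definition coloring_cocycle f (x y : 'F_q) : bool :=
  if [pick i : 'I_(q - 1) | (g ^+ i)%R == x] is Some i then color (f i) (y / x)%R
  else false.

Lemma card_ratio : #|{: ratio}| = (q - 2)%N.
Proof.
rewrite card_sig -[q in RHS](card_Fp q_pr) -[in RHS](cardC (pred2 0%R 1%R)).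
rewrite card2 eq_sym oner_neq0 addKn; apply: eq_card => c.
by rewrite !inE negb_or.
Qed.

Let n_gt0 : 0 < q - 1. Proof. exact: prim_order_gt0 g_prim. Qed.
Let g_neq0 i : (g ^+ i != 0)%R.
Proof.
have q1_neq0 : q - 1 != 0 by rewrite -lt0n.
rewrite expf_neq0 //; apply/eqP => g0; have := prim_expr_order g_prim.
by rewrite g0 expr0n (negPf q1_neq0) => /esym/eqP; rewrite oner_eq0.
Qed.
Let g_log (x : 'F_q) : x != 0%R -> exists i : 'I_(q - 1), x = (g ^+ i)%R.
Proof.
move=> x0; have [i ->] := prim_rootP g_prim (Fp_expf_pred q_pr x0).
by exists i.
Qed.

Lemma coloring_cocycleE f (i : 'I_(q - 1)) y :
  coloring_cocycle f (g ^+ i)%R y = color (f i) (y / g ^+ i)%R.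
Proof.
rewrite /coloring_cocycle; case: pickP => [j|/(_ i)]; last by rewrite eqxx.
rewrite (eq_prim_root_expr g_prim) !modn_small // => /eqP/val_inj -> //.
Qed.

Lemma coloring_cocycle0 f y : coloring_cocycle f 0%R y = false.
Proof. by rewrite /coloring_cocycle; case: pickP => // j; rewrite (negPf (g_neq0 j)). Qed.

Lemma coloring_cocycle_normalized f : normalized (coloring_cocycle f).
Proof.
move=> x y; rewrite coloring_cocycle0; have [->|/g_log[i ->]] := eqVneq x 0%R.
  by rewrite !coloring_cocycle0.
rewrite !coloring_cocycleE mul0r divff // /color.
by split=> //; case: insubP => // c; rewrite eqxx ?andbF.
Qed.

Lemma coloring_cocycle_onto (theta : 'F_q -> 'F_q -> bool) :
  normalized theta -> exists f, coloring_cocycle f =2 theta.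
Proof.
move=> thetaN.
exists [ffun i : 'I_(q - 1) => [ffun c : ratio => theta (g ^+ i)%R (g ^+ i * val c)%R]].
move=> x y; have [->|/g_log[i ->]] := eqVneq x 0%R.
  by rewrite coloring_cocycle0; case: (thetaN 0%R y).
rewrite coloring_cocycleE ffunE /color; case: insubP => [c _ cE|].
  by rewrite ffunE cE mulrC divfK.
(* The excluded ratios 0 and 1 mean [y = 0] and [y = x], where a normalized [theta] vanishes. *)
rewrite negb_and !negbK mulf_eq0 invr_eq0 (negPf (g_neq0 i)) orbF.
case/orP => [/eqP->|]; first by case: (thetaN (g ^+ i)%R 0%R).
rewrite -subr_eq0 -[X in (_ - X)%R](divff (g_neq0 i)) -mulrBl mulf_eq0 invr_eq0.
rewrite (negPf (g_neq0 i)) orbF subr_eq0 => /eqP ->.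
by case: (thetaN (g ^+ i)%R 0%R).
Qed.

(** Scaling by [g ^+ k] keeps the ratio y/x and adds [k] to the exponent of [x], so it acts as the
    [k]-fold rotation. *)
Lemma coloring_cocycle_iso f f' :
  isomorphic (extension_op (coloring_cocycle f)) (extension_op (coloring_cocycle f'))
  <-> fconnect (@rotate (q - 1) {ffun ratio -> bool}) f f'.
Proof.
have [fN f'N] := (coloring_cocycle_normalized f, coloring_cocycle_normalized f').
(* The scaling relation reads [f i = f' (i + k)]: it is [f] that is obtained by rotating [f']. *)
rewrite fconnect_sym; last exact: rotate_inj.
have gM (i k : 'I_(q - 1)) : exists j : 'I_(q - 1),
    j = i + k %[mod q - 1] /\ (g ^+ k * g ^+ i = g ^+ j)%R.
  exists (Ordinal (ltn_pmod (i + k) n_gt0)); rewrite /= modn_mod; split => //.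
  by rewrite -exprD addnC; apply/eqP; rewrite (eq_prim_root_expr g_prim) modn_mod.
have divM u x y : (u != 0 -> (u * y) / (u * x) = y / x :> 'F_q)%R.
  by move=> u0; rewrite invfM mulrACA divff // mul1r.
split=> [/(extension_isoP q_pr q_odd fN f'N)[_ /g_log[k ->] uE]|].
  suff -> : f = iter k (@rotate (q - 1) _) f' by apply: fconnect_iter.
  apply/ffunP => i; have [j [jE gE]] := gM i k.
  rewrite (iter_rotate f' jE); apply/ffunP => c.
  have := uE (g ^+ i)%R (g ^+ i * val c)%R.
  rewrite coloring_cocycleE gE coloring_cocycleE -gE divM // mulrAC divff // mul1r.
  by rewrite /color valK.
move=> /iter_findex <-; set k := findex _ _ _.
apply/extension_isoP => //; first exact: coloring_cocycle_normalized.
exists (g ^+ k)%R => // x y; have [->|/g_log[i ->]] := eqVneq x 0%R.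
  by rewrite mulr0 !coloring_cocycle0.
pose k' := Ordinal (ltn_pmod k n_gt0); have [j [jE gE]] := gM i k'.
have gkE : (g ^+ k = g ^+ k')%R.
  by apply/eqP; rewrite (eq_prim_root_expr g_prim) /= modn_mod.
rewrite coloring_cocycleE gkE gE coloring_cocycleE -gE divM //.
by rewrite (@iter_rotate _ _ _ _ _ j) // jE /= modnDmr.
Qed.

End Colorings.

(** * From isomorphism classes to necklaces *)

Lemma num_nilpotent_loops_necklaces q : prime q -> odd q ->
  num_nilpotent_loops (2 * q) =
  #|equivalence_partition (fconnect (@rotate (q - 1) {ffun ratio q -> bool}))
     [set: {ffun 'I_(q - 1) -> {ffun ratio q -> bool}}]|.
Proof.
move=> q_pr q_odd; have [g g_prim] := Fp_primitive_root q_pr.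
have card2q : #|{: 'F_q * bool}| = (2 * q)%N.
  by rewrite card_prod card_Fp // card_bool mulnC.
pose h (i : 'I_(2 * q)) : 'F_q * bool := enum_val (cast_ord (esym card2q) i).
pose h' u : 'I_(2 * q) := cast_ord card2q (enum_rank u).
have hK : cancel h h' by move=> i; rewrite /h /h' enum_valK cast_ordKV.
have h'K : cancel h' h by move=> u; rewrite /h /h' cast_ordK enum_rankK.
pose cc := coloring_cocycle g.
pose table f : {ffun 'I_(2 * q) * 'I_(2 * q) -> 'I_(2 * q)} :=
  [ffun u => h' (extension_op (cc f) (h u.1) (h u.2))].
have table_iso f : isomorphic (table_op (table f)) (extension_op (cc f)).
  by exists h; [exists h' | move=> x y; rewrite /table_op ffunE h'K].
(* Tables on ['I_(2 * q)] are compared with colorings through [table], which transports each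
   extension along the enumeration [h]. *)
apply: (card_equivalence_partition_preim (f := table)).
- exact: iso_rel_equiv.
- move=> f; rewrite inE; apply/asboolP.
  have ccN := coloring_cocycle_normalized q_pr g_prim f.
  by split; [apply: extension_loop ccN (table_iso f)
            | apply: extension_nilpotent ccN (table_iso f)].
- move=> f f'; apply/asboolP/idP => [ff'|].
    apply/(coloring_cocycle_iso q_pr q_odd g_prim).
    exact: isomorphic_trans (isomorphic_sym (table_iso f)) (isomorphic_trans ff' _).
  move=> /(coloring_cocycle_iso q_pr q_odd g_prim) ff'.
  apply: isomorphic_trans (table_iso f) (isomorphic_trans ff' _).
  exact: isomorphic_sym.
move=> a; rewrite inE => /asboolP[aL aN]; have [[e eN] _ _] := aL.
have [|theta thetaN theta_iso] := nilpotent_extension aL eN q_pr q_odd _ aN.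
  exact: card_ord.
have [f fE] := coloring_cocycle_onto q_pr g_prim thetaN.
exists f; apply/asboolP; apply: isomorphic_trans (table_iso f) _.
apply: isomorphic_trans theta_iso; exists id; first by exists id.
by move=> u v; rewrite /extension_op /cc fE.
Qed.

Unset Implicit Arguments.
Local Open Scope ring_scope.

Theorem theorem7p1 (q : nat) (q_prime : prime q) (q_odd : odd q) :
  (num_nilpotent_loops (2 * q))%:R =
  \sum_(d <- divisors (q - 1))
    d%:R^-1 *
      (2 ^+ ((q - 2) * d) +
       \sum_(D : {set 'I_d} | (D != set0) && (D \subset Pred d))
          (-1) ^+ #|D| * 2 ^+ ((q - 2) * gcd_set D)) :> rat.
Proof.
have q_gt1 := prime_gt1 q_prime.
rewrite num_nilpotent_loops_necklaces // card_necklaces ?subn_gt0 //.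
have cardX : #|{ffun ratio q -> bool}|%:R = 2 ^+ (q - 2) :> rat.
  by rewrite card_ffun card_bool card_ratio // natrX.
rewrite cardX; apply: eq_bigr => d _; rewrite exprM; congr (_ * (_ + _)).
by apply: eq_bigr => D _; rewrite exprM.
Qed.
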